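(* Let $n\ge 1$ and let $\mathcal{A}$ be a *-subalgebra of $M_n$. Then the orthogonal projection $\mathcal{D}(M_n)\to\mathcal{D}(\mathcal{A})$ is open.
   Context: $M_n$ is the algebra of complex $n\times n$ matrices, $I_n$ the identity matrix, $A^*$ the conjugate transpose of $A$, and $\langle A,B\rangle:=\operatorname{tr}(A^*B)$ the Frobenius inner product. A matrix system on $\mathbb{C}^n$ is a complex linear subspace $\mathcal{R}\subset M_n$ such that $A^*\in\mathcal{R}$ for all $A\in\mathcal{R}$ and $I_n\in\mathcal{R}$. A *-subalgebra of $M_n$ is a matrix system on $\mathbb{C}^n$ that is closed under matrix multiplication (in particular it contains $I_n$). For a matrix system $\mathcal{R}$ on $\mathbb{C}^n$ put: $\mathcal{H}(\mathcal{R}):=\{A\in\mathcal{R}: A^*=A\}$; $\mathcal{C}(\mathcal{R})$ the cone of positive semidefinite matrices in $\mathcal{R}$; $\mathcal{C}(\mathcal{R})^\vee:=\{A\in\mathcal{H}(\mathcal{R}): \langle A,B\rangle\ge 0 \text{ for all } B\in\mathcal{C}(\mathcal{R})\}$; and $\mathcal{D}(\mathcal{R}):=\{\rho\in\mathcal{C}(\mathcal{R})^\vee:\operatorname{tr}(\rho)=1\}$ (the density matrices of $\mathcal{R}$). The orthogonal projection of $M_n$ onto $\mathcal{A}$ is the linear map $\pi:M_n\to\mathcal{A}$ determined by $\langle A-\pi(A),B\rangle=0$ for all $B\in\mathcal{A}$. It maps $\mathcal{D}(M_n)$ into $\mathcal{D}(\mathcal{A})$; its restriction $\mathcal{D}(M_n)\to\mathcal{D}(\mathcal{A})$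 is called the orthogonal projection of $\mathcal{D}(M_n)$ onto $\mathcal{D}(\mathcal{A})$. Sets of matrices carry the relative Euclidean topology. A map $f:K\to L$ is open at $x\in K$ if the image of every neighborhood of $x$ in $K$ is a neighborhood of $f(x)$ in $L$; $f$ is open if it is open at every point of $K$. *)

(* Defs.v *)
From HB Require Import structures.
From mathcomp Require Import all_boot all_order all_algebra.
From mathcomp Require Import spectral.
From mathcomp Require Import complex.
From mathcomp Require Import all_classical all_reals all_analysis.

Set Implicit Arguments.
Unset Strict Implicit.
Unset Printing Implicit Defensive.

Import Order.TTheory GRing.Theory Num.Theory.
Import numFieldNormedType.Exports.
Local Open Scope classical_set_scope.
Local Open Scope ring_scope.
Local Open Scope sesquilinear_scope.

(* [R[i]] packaged as a [numClosedFieldType]: the topology of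
   MathComp-Analysis is attached to the structures [numFieldType] and
   [numClosedFieldType], and is not found from the bare head symbol
   [complex].  The order on it is the partial one of MathComp, for which
   [0 <= z] means that [z] is real and nonnegative. *)
Definition Cplx (R : realType) : numClosedFieldType := R[i].

Section MatrixSystems.
Variables (R : realType) (n : nat).
Local Notation C := (Cplx R).
Local Notation M := 'M[C]_n.

Definition frob (A B : M) : C := \tr (A ^t* *m B).

Definition is_matrix_system (S : {vspace M}) : Prop :=
  (forall A, A \in S -> A ^t* \in S) /\ 1%:M \in S.

Definition is_star_subalgebra (S : {vspace M}) : Prop :=
  is_matrix_system S /\ (forall A B, A \in S -> B \in S -> A *m B \in S).

Definition psd (A : M) : Prop :=
  A ^t* = A /\ (forall v : 'cV[C]_n, 0 <= (v ^t* *m A *m v) 0 0).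

Definition herm_part (S : {vspace M}) : set M :=
  [set A | A \in S /\ A ^t* = A].

Definition psd_cone (S : {vspace M}) : set M := [set A | A \in S /\ psd A].

Definition dual_cone (S : {vspace M}) : set M :=
  [set A | herm_part S A /\ (forall B, psd_cone S B -> 0 <= frob A B)].

Definition density (S : {vspace M}) : set M :=
  [set rho | dual_cone S rho /\ \tr rho = 1].

Definition is_orth_proj (S : {vspace M}) (p : 'End(M)) : Prop :=
  forall A, p A \in S /\ (forall B, B \in S -> frob (A - p A) B = 0).

(* [xget] picks the map so determined; its default value [0] is never used, by
   [orth_proj_exists]. *)
Definition orth_proj (S : {vspace M}) : 'End(M) := xget 0 (is_orth_proj S).

Lemma frob_herm (A B : M) : frob A B = (frob B A)^*.
Proof.
rewrite /frob /mxtrace rmorph_sum /=; apply: eq_bigr => i _.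
rewrite !mxE rmorph_sum /=; apply: eq_bigr => j _.
by rewrite !mxE rmorphM /= conjCK mulrC.
Qed.

Lemma frobDr (A B B' : M) : frob A (B + B') = frob A B + frob A B'.
Proof. by rewrite /frob mulmxDr mxtraceD. Qed.

Lemma frobZr (A B : M) (a : C) : frob A (a *: B) = a * frob A B.
Proof. by rewrite /frob -scalemxAr mxtraceZ. Qed.

Lemma frobBr (A B B' : M) : frob A (B - B') = frob A B - frob A B'.
Proof. by rewrite frobDr -scaleN1r frobZr mulN1r. Qed.

Lemma frobBl (A A' B : M) : frob (A - A') B = frob A B - frob A' B.
Proof. by rewrite frob_herm frobBr rmorphB /= -!frob_herm. Qed.

Lemma frob_eq0 (A : M) : frob A A = 0 -> A = 0.
Proof.
have frobE : frob A A = \sum_i \sum_j `|A j i| ^+ 2.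
  rewrite /frob /mxtrace; apply: eq_bigr => i _; rewrite mxE.
  by apply: eq_bigr => j _; rewrite !mxE normCK mulrC.
rewrite frobE => A0; apply/matrixP => j i; rewrite mxE.
have /= := psumr_eq0P _ A0 (i := i) isT.
move=> /(_ (fun i _ => sumr_ge0 _ (fun j _ => exprn_ge0 2 (normr_ge0 _)))) => A0i.
have /= := psumr_eq0P _ A0i (i := j) isT.
move=> /(_ (fun j _ => exprn_ge0 2 (normr_ge0 _)))/eqP.
by rewrite sqrf_eq0 normr_eq0 => /eqP.
Qed.

Lemma frob_span (S : {vspace M}) (A : M) :
  (forall i : 'I_(\dim S), frob (vbasis S)`_i A = 0) ->
  forall B, B \in S -> frob B A = 0.
Proof.
move=> A0 B /coord_vbasis->; rewrite frob_herm.
elim/big_rec: _ => [|i X _ IH]; first by rewrite -(scale0r 0) frobZr mul0r conjC0.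
by rewrite frobDr frobZr rmorphD rmorphM /= -frob_herm A0 mulr0 add0r.
Qed.

Lemma orth_proj_exists (S : {vspace M}) : exists p, is_orth_proj S p.
Proof.
pose f (A : M) : 'rV[C]_(\dim S) := \row_i frob (vbasis S)`_i A.
have f_lin : linear f.
  by move=> a A B; apply/rowP => i; rewrite !mxE frobDr frobZr.
pose f' := HB.pack_for {linear M -> 'rV[C]_(\dim S)} f
  (GRing.isLinear.Build _ _ _ _ f f_lin).
pose F := linfun f'; have FE A i : F A 0 i = frob (vbasis S)`_i A.
  by rewrite lfunE /= mxE.
have kerF : (S :&: lker F)%VS = 0%VS.
  apply/eqP; rewrite -subv0; apply/subvP => A /memv_capP[AS].
  rewrite memv_ker memv0 => /eqP FA0; apply/eqP/frob_eq0.
  by apply: (frob_span _ AS) => i; rewrite -FE FA0 mxE.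
have imF : (F @: S)%VS = fullv.
  by apply/eqP; rewrite eqEdim subvf dimvf limg_dim_eq //= /dim /= mul1n.
pose g := (F \o projv S)%VF.
have img : limg g = fullv by rewrite limg_comp limg_proj.
exists (projv S \o g^-1 \o F)%VF => A.
rewrite !comp_lfunE /=; split; first exact: memv_proj.
set Y := projv S _.
have FY : F Y = F A.
  by rewrite /Y -[F (projv S _)]comp_lfunE limg_lfunVK // img memvf.
move=> B BS; rewrite frob_herm (frob_span _ BS) ?conjC0 // => i.
by rewrite frobBr -!FE FY subrr.
Qed.

Lemma orth_projP (S : {vspace M}) : is_orth_proj S (orth_proj S).
Proof. by have [p Sp] := orth_proj_exists S; exact: (xgetI 0 Sp). Qed.

Lemma orth_proj_unique (S : {vspace M}) (p : 'End(M)) :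
  is_orth_proj S p -> p = orth_proj S.
Proof.
move=> Sp; apply/lfunP => A; have [pS pO] := Sp A.
have [qS qO] := orth_projP S A.
have dS : p A - orth_proj S A \in S by rewrite rpredB.
apply/eqP; rewrite -subr_eq0; apply/eqP/frob_eq0.
rewrite {1}(_ : p A - _ = (A - orth_proj S A) - (A - p A)).
  by rewrite frobBl pO // qO // subrr.
by rewrite opprB [RHS]addrC addrA subrK.
Qed.

Lemma orth_proj_density (S : {vspace M}) (rho : M) : is_matrix_system S ->
  density {:M} rho -> density S (orth_proj S rho).
Proof.
move=> [Sstar S1] [[[_ rhoh] rho_ge0] rho1].
have [pS pO] := orth_projP S rho; set q := orth_proj S rho in pS pO *.
have qE B : B \in S -> frob q B = frob rho B.
  by move=> BS; apply/esym/eqP; rewrite -subr_eq0 -frobBl pO.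
have frobS (A B : M) : frob (A ^t*) (B ^t*) = frob B A.
  rewrite /frob mxtrace_mulC; congr (\tr (_ *m _)).
  by apply/matrixP => i j; rewrite !mxE conjCK.
have starK (A : M) : (A ^t*) ^t* = A.
  by apply/matrixP => i j; rewrite !mxE conjCK.
have qsE B : B \in S -> frob (q ^t*) B = frob q B.
  move=> BS; rewrite qE // -[in RHS]rhoh -(starK B) !frobS.
  by rewrite frob_herm qE ?Sstar // -frob_herm.
have qh : q ^t* = q.
  apply/eqP; rewrite -subr_eq0; apply/eqP/frob_eq0.
  by rewrite frobBl qsE ?subrr // rpredB ?Sstar.
split; last first.
  have tr1 (A : M) : A ^t* = A -> \tr A = frob A 1%:M.
    by move=> Ah; rewrite /frob Ah mulmx1.
  by rewrite tr1 // qE // -tr1.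
split=> // B [BS Bpsd]; rewrite qE //; apply: rho_ge0.
by split; rewrite ?memvf.
Qed.

End MatrixSystems.

Definition open_map_at (T U : topologicalType) (K : set T) (L : set U)
    (f : T -> U) (x : T) : Prop :=
  forall N : set T, N `<=` K -> within K (nbhs x) N ->
    within L (nbhs (f x)) (f @` N).

Definition open_map_on (T U : topologicalType) (K : set T) (L : set U)
    (f : T -> U) : Prop :=
  forall x, K x -> open_map_at K L f x.

(* Main.v *)
Require Import Defs.
From mathcomp Require Import all_boot all_order all_algebra.
From mathcomp Require Import spectral.
From mathcomp Require Import all_classical all_reals all_analysis.

Import numFieldNormedType.Exports.
Import Order.TTheory GRing.Theory Num.Theory.

Set Implicit Arguments.
Unset Strict Implicit.
Unset Printing Implicit Defensive.

(** Write sigma for the orthogonal projection of a state rho onto the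
   *-subalgebra A.  Openness at rho amounts to lifting every state tau of A
   close to sigma to a state of the full matrix algebra that projects to tau
   and is close to rho.  An explicit continuous lift does this:

     lift tau = t (tau W rho W tau) + (tau - t (tau W tau)),

   where W is the pseudo-inverse of sigma and t = t(tau) is a scalar in (0, 1]
   which tends to 1 as tau tends to sigma.

   - It projects to tau.  W lies in A, being a polynomial in sigma, and the
     orthogonal projection onto A is a morphism of A-bimodules
     ([orth_proj_bimodule]); hence tau W rho W tau projects to
     tau W sigma W tau = tau W tau, which the second summand cancels
     ([orth_proj_lift_state]).
   - It is positive semidefinite.  The first summand is a multiple of
     X rho X^* with X = tau W.  For the second, put G = sqrt W.  The operators sqrt tau G G sqrt tau and
     G tau G have the same norm, so t (tau W tau) <= tau as soon as
     t (G tau G) <= 1.  Now G tau G is the support projection of sigma plus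
     E = G (tau - sigma) G, and E is at most the sum c of the moduli of its
     entries, so t = 1 / (1 + c) is small enough ([psd_1B_damping],
     [psd_remainder]).
   - It is continuous in tau ([cvg_lift_state]), and at tau = sigma it equals
     rho, because the support of rho is contained in that of sigma
     ([orth_proj_support], [lift_state_id]).

   The trace of the lift is that of tau, since 1 lies in A.  Finally, the states
   of A are exactly its positive semidefinite matrices of trace 1
   ([densityP]): the cone of A is self-dual, because A contains the spectral
   projections of its Hermitian elements. *)

(** * Limits of matrix-valued functions *)

Section MatrixLimits.
Local Open Scope classical_set_scope.
Local Open Scope ring_scope.
Variables (K : numFieldType) (T : Type) (F : set_system T) (FF : Filter F).

(** The topology on matrices is the product topology, which reduces limits of
   matrix expressions to limits of scalars. *)
Lemma mx_cvgP m n (f : T -> 'M[K]_(m, n)) (a : 'M[K]_(m, n)) :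
  f @ F --> a <-> forall i j, f x i j @[x --> F] --> a i j.
Proof.
split=> [fa i j|fa].
  exact: (@cvg_comp _ _ _ f (fun M : 'M[K]_(m, n) => M i j) _ _ _ fa
    (@coord_continuous K m n i j a)).
move=> N [P aP PN]; have : F (fun x => forall i j, P i j (f x i j)).
  by apply: filter_forall => i; apply: filter_forall => j; exact: fa.
by apply: (@filterS _ F) => x Px; exact: PN.
Qed.

Lemma cvg_bigsum (I : finType) (f : I -> T -> K) (a : I -> K) :
  (forall i, f i x @[x --> F] --> a i) ->
  \sum_i f i x @[x --> F] --> \sum_i a i.
Proof.
move=> fa; elim: (index_enum I) => [|i r IH].
  by rewrite big_nil; under eq_fun do rewrite big_nil; exact: cvg_cst.
rewrite big_cons; under eq_fun do rewrite big_cons.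
exact: cvgD.
Qed.

Lemma cvg_mxD m n (f g : T -> 'M[K]_(m, n)) (a b : 'M[K]_(m, n)) :
  f @ F --> a -> g @ F --> b -> f x + g x @[x --> F] --> a + b.
Proof.
move=> /mx_cvgP fa /mx_cvgP gb; apply/mx_cvgP => i j; rewrite mxE.
by under eq_fun do rewrite mxE; apply: cvgD.
Qed.

Lemma cvg_mxZ m n (s : T -> K) (f : T -> 'M[K]_(m, n)) (c : K) (a : 'M[K]_(m, n)) :
  s @ F --> c -> f @ F --> a -> s x *: f x @[x --> F] --> c *: a.
Proof.
move=> sc /mx_cvgP fa; apply/mx_cvgP => i j; rewrite mxE.
by under eq_fun do rewrite mxE; apply: cvgM.
Qed.

Lemma cvg_mxB m n (f g : T -> 'M[K]_(m, n)) (a b : 'M[K]_(m, n)) :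
  f @ F --> a -> g @ F --> b -> f x - g x @[x --> F] --> a - b.
Proof.
move=> fa gb; rewrite -scaleN1r; under eq_fun do rewrite -scaleN1r.
by apply: cvg_mxD => //; apply: cvg_mxZ => //; exact: cvg_cst.
Qed.

Lemma cvg_mulmx m p n (f : T -> 'M[K]_(m, p)) (g : T -> 'M[K]_(p, n))
    (a : 'M[K]_(m, p)) (b : 'M[K]_(p, n)) :
  f @ F --> a -> g @ F --> b -> f x *m g x @[x --> F] --> a *m b.
Proof.
move=> /mx_cvgP fa /mx_cvgP gb; apply/mx_cvgP => i j; rewrite mxE.
by under eq_fun do rewrite mxE; apply: cvg_bigsum => k; apply: cvgM.
Qed.

End MatrixLimits.

(** * Algebraic preliminaries *)

Section AlgebraicPreliminaries.
Local Open Scope ring_scope.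

(** For Hermitian [X] and [G] and [t >= 0], the summands on the right are
   congruent to [X] and to a multiple of [1 - t G X G], so that positivity of [X] and of [1 - t G X G] gives
   [t (X G G X) <= X] without a square root of [X].  The first summand
   completes the square in [X]; the second is what the completion leaves. *)
Lemma damped_square_identity (K : comNzRingType) n (t : K) (X G : 'M[K]_n) :
  X - t *: (X *m (G *m G) *m X) =
    (1%:M - t *: (X *m (G *m G))) *m X *m (1%:M - t *: (G *m G *m X)) +
    t *: (X *m G *m (1%:M - t *: (G *m X *m G)) *m (G *m X)).
Proof.
rewrite !(mulmxBl, mulmxBr, mul1mx, mulmx1) -!(scalemxAl, scalemxAr) !mulmxA.
by rewrite scalerBr subrK.
Qed.

Lemma poly_interpolation (F : fieldType) (f : F -> F) (s : seq F) :
  exists p : {poly F}, forall x, x \in s -> p.[x] = f x.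
Proof.
elim: s => [|x s [p ps]]; first by exists 0.
have [xs|xs] := boolP (x \in s).
  by exists p => y; rewrite inE => /orP[/eqP->|]; exact: ps.
pose q := \prod_(z <- s) ('X - z%:P).
have qx : q.[x] != 0 by rewrite -[_ == 0]/(root q x) root_prod_XsubC.
exists (p + ((f x - p.[x]) / q.[x]) *: q) => y.
rewrite inE hornerD hornerZ => /orP[/eqP->|ys]; first by rewrite divfK // subrKC.
have /eqP-> : root q y by rewrite root_prod_XsubC.
by rewrite mulr0 addr0 ps.
Qed.

End AlgebraicPreliminaries.

(** * Adjoints *)

Section HermitianMatrices.
Local Open Scope classical_set_scope.
Local Open Scope ring_scope.
Local Open Scope sesquilinear_scope.

Variables (R : realType) (n : nat).
Local Notation C := (Cplx R).
Local Notation M := 'M[C]_n.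
Implicit Types (A B X Y Z : M) (S : {vspace M}) (f g : C -> C).

Lemma adjM m p q (A : 'M[C]_(m, p)) (B : 'M[C]_(p, q)) :
  (A *m B) ^t* = B ^t* *m A ^t*.
Proof. by rewrite trmx_mul map_mxM. Qed.

Lemma adjD A B : (A + B) ^t* = A ^t* + B ^t*.
Proof. by rewrite linearD map_mxD. Qed.

Lemma adjB A B : (A - B) ^t* = A ^t* - B ^t*.
Proof. by rewrite linearB map_mxB. Qed.

Lemma adjZ (a : C) A : (a *: A) ^t* = a^* *: A ^t*.
Proof. by rewrite linearZ map_mxZ. Qed.

Lemma adj_scalar (a : C) : (a%:M : M) ^t* = (a^*)%:M.
Proof. by rewrite tr_scalar_mx map_scalar_mx. Qed.

Lemma adj_diag (d : 'rV[C]_n) : (diag_mx d) ^t* = diag_mx (map_mx Num.conj d).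
Proof. by rewrite tr_diag_mx map_diag_mx. Qed.

Lemma frob_sandwich X Y Z B :
  frob (Y *m X *m Z) B = frob X (Y ^t* *m B *m Z ^t*).
Proof. by rewrite /frob !adjM -!mulmxA mxtrace_mulC -!mulmxA. Qed.

(** * Positive semidefinite matrices *)

Lemma psd_congr A Y : psd A -> psd (Y *m A *m Y ^t*).
Proof.
move=> [Ah Ap]; split; first by rewrite !adjM trmxCK Ah mulmxA.
by move=> v; have := Ap (Y ^t* *m v); rewrite adjM trmxCK !mulmxA.
Qed.

Lemma psdD A B : psd A -> psd B -> psd (A + B).
Proof.
move=> [Ah Ap] [Bh Bp]; split; first by rewrite adjD Ah Bh.
by move=> v; rewrite mulmxDr mulmxDl mxE addr_ge0.
Qed.

Lemma psdZ (a : C) A : 0 <= a -> psd A -> psd (a *: A).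
Proof.
move=> a0 [Ah Ap]; split; first by rewrite adjZ Ah geC0_conj.
by move=> v; rewrite -scalemxAr -scalemxAl mxE mulr_ge0.
Qed.

Lemma psd_diag_ge0 A i : psd A -> 0 <= A i i.
Proof.
move=> [_ /(_ (delta_mx i 0))].
by rewrite trmx_delta map_delta_mx -rowE -colE !mxE.
Qed.

Lemma psd_tr_ge0 A : psd A -> 0 <= \tr A.
Proof. by move=> Ap; apply: sumr_ge0 => i _; exact: psd_diag_ge0. Qed.

Lemma psd_diag_mx (d : 'rV[C]_n) : (forall i, 0 <= d 0 i) -> psd (diag_mx d).
Proof.
move=> d0; split.
  rewrite adj_diag; congr diag_mx; apply/rowP => i; rewrite mxE.
  by rewrite geC0_conj.
move=> v; rewrite mxE sumr_ge0 // => i _.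
by rewrite mul_mx_diag !mxE mulrAC mulr_ge0 // mulrC mul_conjC_ge0.
Qed.

Definition entry_sum A : C := \sum_i \sum_j `|A i j|.

Lemma entry_sum_ge0 A : 0 <= entry_sum A.
Proof. by apply: sumr_ge0 => i _; apply: sumr_ge0. Qed.

(** A crude continuous bound for the largest eigenvalue: [|v i| |v j|] is at
   most the squared norm of [v], hence [v^* A v] is at most the sum of the
   [|A i j|] times this squared norm. *)
Lemma psd_entry_sum A : A ^t* = A -> psd ((entry_sum A)%:M - A).
Proof.
move=> Ah; split.
  by rewrite adjB Ah adj_scalar geC0_conj // entry_sum_ge0.
move=> v; set q := (v ^t* *m A *m v) 0 0.
pose N := \sum_k `|v k 0| ^+ 2.
have vN k : `|v k 0| ^+ 2 <= N.
  rewrite /N (bigD1 k) //= lerDl; apply: sumr_ge0 => i _; exact: exprn_ge0.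
have vvN i j : `|v i 0| * `|v j 0| <= N.
  rewrite -(@ler_pMn2r _ 2) //.
  apply: le_trans (real_leif_mean_square_scaled _ _) _; rewrite ?normr_real //.
  by rewrite mulr2n lerD.
have qr : q \is Num.real.
  apply/CrealP; rewrite /q.
  have -> : ((v ^t* *m A *m v) 0 0)^* = ((v ^t* *m A *m v) ^t*) 0 0.
    by rewrite !mxE.
  by rewrite !adjM trmxCK Ah mulmxA.
have -> : (v ^t* *m ((entry_sum A)%:M - A) *m v) 0 0 = entry_sum A * N - q.
  rewrite mulmxBr mulmxBl mul_mx_scalar -scalemxAl mxE [X in _ + X]mxE mxE.
  congr (_ * _ - _); rewrite mxE.
  by apply: eq_bigr => k _; rewrite !mxE normCK mulrC.
rewrite subr_ge0; apply: le_trans (real_ler_norm qr) _.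
rewrite /q mxE; apply: le_trans (ler_norm_sum _ _ _) _.
rewrite /entry_sum exchange_big /= mulr_suml; apply: ler_sum => j _.
rewrite mxE normrM.
apply: le_trans (_ : (\sum_i `|A i j| * `|v i 0|) * `|v j 0| <= _).
  rewrite ler_wpM2r //; apply: le_trans (ler_norm_sum _ _ _) _.
  by apply: ler_sum => i _; rewrite !mxE normrM norm_conjC mulrC.
rewrite !mulr_suml; apply: ler_sum => i _.
by rewrite -mulrA ler_wpM2l.
Qed.

(** * Functional calculus of Hermitian matrices *)

(** The functional calculus [f(A)], computed in an orthonormal eigenbasis
   of [A]. *)
Definition hcalc A f : M :=
  (spectralmx A) ^t* *m diag_mx (map_mx f (spectral_diag A)) *m spectralmx A.

Lemma spectral_adjK A : (spectralmx A) ^t* *m spectralmx A = 1%:M.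
Proof.
by rewrite -(invmx_unitary (spectral_unitarymx A)) mulVmx // spectral_unit.
Qed.

Lemma spectral_mulK A : spectralmx A *m (spectralmx A) ^t* = 1%:M.
Proof. exact/unitarymxP/spectral_unitarymx. Qed.

Lemma eq_hcalc A f g :
  (forall i, f (spectral_diag A 0 i) = g (spectral_diag A 0 i)) ->
  hcalc A f = hcalc A g.
Proof.
move=> fg; rewrite /hcalc (_ : map_mx f _ = map_mx g (spectral_diag A)) //.
by apply/rowP => i; rewrite !mxE.
Qed.

Lemma hcalc_id A : A ^t* = A -> hcalc A id = A.
Proof.
move=> Ah; rewrite /hcalc [map_mx id _]map_mx_id // -(invmx_unitary (spectral_unitarymx A)).
apply/esym/orthomx_spectralP/hermitian_normalmx.
by apply/is_hermitianmxP; rewrite expr0 scale1r.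
Qed.

Lemma hcalcM A f g : hcalc A f *m hcalc A g = hcalc A (fun x => f x * g x).
Proof.
rewrite /hcalc (_ : map_mx (fun x => f x * g x) _ =
  \row_i (map_mx f (spectral_diag A) 0 i * map_mx g (spectral_diag A) 0 i)).
  by rewrite -mulmx_diag -!mulmxA (mulmxA (spectralmx A)) spectral_mulK mul1mx.
by apply/rowP => i; rewrite !mxE.
Qed.

Lemma hcalc1B A f : 1%:M - hcalc A f = hcalc A (fun x => 1 - f x).
Proof.
rewrite /hcalc (_ : diag_mx (map_mx (fun x => 1 - f x) _) =
  1%:M - diag_mx (map_mx f (spectral_diag A))).
  by rewrite mulmxBr mulmxBl mulmx1 spectral_adjK.
by apply/matrixP => i j; rewrite !mxE -mulrnBl.
Qed.

Lemma psd_hcalc A f : (forall i, 0 <= f (spectral_diag A 0 i)) -> psd (hcalc A f).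
Proof.
move=> f0; rewrite /hcalc -[X in _ *m X]trmxCK; apply: psd_congr.
by apply: psd_diag_mx => i; rewrite mxE.
Qed.

Lemma tr_hcalc A f : \tr (hcalc A f) = \sum_i f (spectral_diag A 0 i).
Proof.
rewrite /hcalc -mulmxA mxtrace_mulC -mulmxA spectral_mulK mulmx1 mxtrace_diag.
by apply: eq_bigr => i _; rewrite mxE.
Qed.

(** An eigenvalue is a diagonal entry of [A] written in its eigenbasis. *)
Lemma psd_spectral_diag A i : psd A -> 0 <= spectral_diag A 0 i.
Proof.
move=> Ap; have [Ah _] := Ap.
have := psd_diag_ge0 i (psd_congr (spectralmx A) Ap).
rewrite -{2}(hcalc_id Ah) /hcalc [map_mx id _]map_mx_id // !mulmxA spectral_mulK mul1mx.
by rewrite -mulmxA spectral_mulK mulmx1 mxE eqxx mulr1n.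
Qed.

Lemma star_subalgebra_horner_mx m (S : {vspace 'M[C]_m.+1}) (X : 'M[C]_m.+1) (p : {poly C}) :
  is_star_subalgebra S -> X \in S -> horner_mx X p \in S.
Proof.
move=> [[_ S1] SM] XS; elim/poly_ind: p => [|p c IH]; first by rewrite rmorph0 rpred0.
rewrite rmorphD rmorphM /= horner_mx_X horner_mx_C.
apply: rpredD; first exact: SM.
by rewrite -scalemx1; apply: rpredZ.
Qed.

End HermitianMatrices.

(** * Positivity in a *-subalgebra *)

Section StarSubalgebras.
Local Open Scope classical_set_scope.
Local Open Scope ring_scope.
Local Open Scope sesquilinear_scope.

Variables (R : realType).
Local Notation C := (Cplx R).

(** [f(A)] is a polynomial in [A]: interpolate [f] at the eigenvalues. *)
Lemma hcalc_mem n (S : {vspace 'M[C]_n}) (A : 'M[C]_n) f : is_star_subalgebra S ->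
  A \in S -> A ^t* = A -> hcalc A f \in S.
Proof.
case: n S A => [|n] S A Salg AS Ah; first by rewrite [hcalc A f]flatmx0 mem0v.
have [p pf] := @poly_interpolation _ f [seq spectral_diag A 0 i | i <- enum 'I_n.+1].
rewrite (_ : hcalc A f = horner_mx A p); last first.
  rewrite -{2}(hcalc_id Ah) /hcalc -(invmx_unitary (spectral_unitarymx A)).
  rewrite [map_mx id _]map_mx_id //.
  rewrite horner_mx_uconjC ?spectral_unit // horner_mx_diag.
  rewrite (_ : map_mx f _ = map_mx (horner p) (spectral_diag A)) //.
  apply/rowP => i; rewrite !mxE pf //.
  by apply/mapP; exists i; rewrite ?mem_enum.
exact: star_subalgebra_horner_mx.
Qed.

Lemma psd_factor n (X : 'M[C]_n) : psd X -> exists H : 'M[C]_n, X = H ^t* *m H.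
Proof.
move=> Xp; have [Xh _] := Xp; exists (hcalc X sqrtC).
have [-> _] : psd (hcalc X sqrtC).
  by apply: psd_hcalc => i; rewrite sqrtC_ge0 psd_spectral_diag.
rewrite hcalcM -{1}(hcalc_id Xh); apply: eq_hcalc => i.
by rewrite -expr2 sqrtCK.
Qed.

Lemma psd_frob_ge0 n (X B : 'M[C]_n) : psd X -> psd B -> 0 <= frob X B.
Proof.
move=> Xp /psd_factor[H ->]; have [Xh _] := Xp.
rewrite /frob Xh mulmxA mxtrace_mulC mulmxA; apply: psd_tr_ge0.
exact: psd_congr.
Qed.

Lemma psd_kernel n (X Q : 'M[C]_n) : psd X ->
  \tr (Q ^t* *m X *m Q) = 0 -> X *m Q = 0.
Proof.
move=> /psd_factor[H ->] HQ0.
have /frob_eq0 HQ : frob (H *m Q) (H *m Q) = 0 by rewrite /frob adjM -HQ0 !mulmxA.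
by rewrite -mulmxA HQ mulmx0.
Qed.

(** The positive semidefinite cone of a *-subalgebra is self-dual.  A Hermitian
   [X] is tested against its spectral projection onto the negative
   eigenvalues: the pairing is the sum of these eigenvalues, so there are
   none. *)
Lemma densityP n (S : {vspace 'M[C]_n}) (X : 'M[C]_n) : is_star_subalgebra S ->
  density S X <-> [/\ X \in S, psd X & \tr X = 1].
Proof.
move=> Salg; split; last first.
  move=> [XS Xp X1]; have [Xh _] := Xp.
  by split=> //; split=> // B [_ Bp]; exact: psd_frob_ge0.
move=> [[[XS Xh] Xpos] X1]; split=> //.
pose d := spectral_diag X.
(* [C] is only partially ordered: sign distinctions on eigenvalues need this. *)
have dr i : d 0 i \is Num.real.
  have : X \is hermsymmx by apply/is_hermitianmxP; rewrite expr0 scale1r.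
  by move/hermitian_spectral_diag_real/mxOverP.
pose neg (x : C) : C := (x < 0)%R%:R.
have : 0 <= \sum_i d 0 i * neg (d 0 i).
  rewrite -(tr_hcalc X (fun x => x * neg x)) -(hcalcM X id) hcalc_id //.
  rewrite -{1}Xh; apply: Xpos; split; first exact: hcalc_mem.
  by apply: psd_hcalc => i; rewrite ler0n.
have neg_le0 i : d 0 i * neg (d 0 i) <= 0.
  by rewrite /neg; case: (boolP (_ < 0)) => [/ltW|_]; rewrite ?mulr1 ?mulr0.
move=> sum_ge0.
have /eqP : \sum_i - (d 0 i * neg (d 0 i)) = 0.
  apply/eqP; rewrite eq_le sumrN oppr_le0 sum_ge0 oppr_ge0 /=.
  by apply: sumr_le0.
rewrite psumr_eq0 => [/allP d0|i _]; last by rewrite oppr_ge0.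
rewrite -(hcalc_id Xh); apply: psd_hcalc => i.
have := d0 i (mem_index_enum i); rewrite /= oppr_eq0 /neg.
have [//|dn] := real_ge0P (dr i).
by rewrite mulr1 lt_eqF.
Qed.

Lemma star_subalgebra_full n : is_star_subalgebra {: 'M[C]_n}.
Proof. by split; [split=> [A _|]|move=> A B _ _]; exact: memvf. Qed.

(** * Pseudo-inverses *)

(** As the inverse of [0] is [0], this is the Moore-Penrose inverse of a
   Hermitian matrix, and [X *m hinv X] is its support projection. *)
Definition hinv n (X : 'M[C]_n) : 'M[C]_n := hcalc X (fun x => x^-1).
Definition hinv_sqrt n (X : 'M[C]_n) : 'M[C]_n := hcalc X (fun x => sqrtC x^-1).

Lemma psd_hinv n (X : 'M[C]_n) : psd X -> psd (hinv X).
Proof. by move=> Xp; apply: psd_hcalc => i; rewrite invr_ge0 psd_spectral_diag. Qed.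

Lemma psd_hinv_sqrt n (X : 'M[C]_n) : psd X -> psd (hinv_sqrt X).
Proof.
move=> Xp; apply: psd_hcalc => i.
by rewrite sqrtC_ge0 invr_ge0 psd_spectral_diag.
Qed.

Lemma hinv_sqrt_sq n (X : 'M[C]_n) : hinv_sqrt X *m hinv_sqrt X = hinv X.
Proof. by rewrite /hinv_sqrt hcalcM; apply: eq_hcalc => i; rewrite -expr2 sqrtCK. Qed.

Lemma mulmx_hinvK n (X : 'M[C]_n) : X ^t* = X -> X *m hinv X *m X = X.
Proof.
move=> /hcalc_id Xid; rewrite -{1 3 4}Xid !hcalcM; apply: eq_hcalc => i /=.
have [->|d0] := eqVneq (spectral_diag X 0 i) 0; first by rewrite mul0r mul0r.
by rewrite mulfV // mul1r.
Qed.

Lemma hinv_mulmxK n (X : 'M[C]_n) : X ^t* = X -> hinv X *m X *m hinv X = hinv X.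
Proof.
move=> /hcalc_id Xid; rewrite -{2}Xid !hcalcM; apply: eq_hcalc => i /=.
have [->|d0] := eqVneq (spectral_diag X 0 i) 0; last by rewrite mulVf ?mul1r.
by rewrite invr0 !mulr0.
Qed.

(** The subtracted matrix is the support projection of [X]. *)
Lemma psd_1B_hinv_sqrt_congr n (X : 'M[C]_n) : X ^t* = X ->
  psd (1%:M - hinv_sqrt X *m X *m hinv_sqrt X).
Proof.
move=> /hcalc_id Xid; rewrite -{2}Xid !hcalcM hcalc1B; apply: psd_hcalc => i /=.
have [->|d0] := eqVneq (spectral_diag X 0 i) 0.
  by rewrite mulr0 mul0r subr0 ler01.
by rewrite mulrAC -expr2 sqrtCK mulVf // subrr.
Qed.

(** * The orthogonal projection and its local lift *)

Lemma cvg_entry_sum (T : Type) (F : set_system T) (FF : Filter F) n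
    (f : T -> 'M[C]_n) (a : 'M[C]_n) :
  f @ F --> a -> entry_sum (f x) @[x --> F] --> entry_sum a.
Proof.
move=> /mx_cvgP fa; apply: cvg_bigsum => i; apply: cvg_bigsum => j.
exact: cvg_norm.
Qed.

Section Lift.
Variables (n : nat) (A : {vspace 'M[C]_n}) (A_alg : is_star_subalgebra A).
Implicit Types rho sigma tau B X Y Z : 'M[C]_n.

Lemma frob_orth_proj rho B : B \in A -> frob (orth_proj A rho) B = frob rho B.
Proof.
move=> BA; have [_ /(_ _ BA)] := orth_projP A rho.
by rewrite frobBl => /subr0_eq ->.
Qed.

Lemma tr_orth_proj X : \tr (orth_proj A X) = \tr X.
Proof.
have trE Y : \tr Y = frob 1%:M Y by rewrite /frob adj_scalar conjC1 mul1mx.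
have [[_ A1] _] := A_alg.
by rewrite (trE (orth_proj A X)) (trE X) frob_herm [RHS]frob_herm frob_orth_proj.
Qed.

Lemma orth_proj_eq X Y : Y \in A ->
  (forall B, B \in A -> frob X B = frob Y B) -> orth_proj A X = Y.
Proof.
move=> YA XY; have [pA _] := orth_projP A X.
have dA : orth_proj A X - Y \in A by exact: memvB.
apply/subr0_eq/frob_eq0.
by rewrite frobBl frob_orth_proj // XY // subrr.
Qed.

Lemma orth_proj_id X : X \in A -> orth_proj A X = X.
Proof. by move=> XA; exact: orth_proj_eq. Qed.

(** In the Frobenius pairing, multiplication by elements of [A] on either side
   can be moved to the test matrix, which stays in [A]. *)
Lemma orth_proj_bimodule X Y Z : Y \in A -> Z \in A ->
  orth_proj A (Y *m X *m Z) = Y *m orth_proj A X *m Z.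
Proof.
have [[Astar _] AM] := A_alg; have [pA _] := orth_projP A X.
move=> YA ZA; apply: orth_proj_eq => [|B BA]; first exact: (AM _ _ (AM _ _ YA pA)).
rewrite !frob_sandwich frob_orth_proj //.
exact: (AM _ _ (AM _ _ (Astar _ YA) BA) (Astar _ ZA)).
Qed.

(** The support of [rho] lies in that of its projection [sigma].  The complement
   [Q] of the support of [sigma] belongs to [A], so [rho] and [sigma] have the
   same pairing with [Q Q^*]; this makes the trace of [Q^* rho Q] vanish. *)
Lemma orth_proj_support rho : psd rho -> psd (orth_proj A rho) ->
  rho *m hinv (orth_proj A rho) *m orth_proj A rho = rho.
Proof.
move=> rho_psd sigma_psd; set sigma := orth_proj A rho in sigma_psd *.
have [[Astar A1] AM] := A_alg; have [sigmah _] := sigma_psd.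
have sigmaA : sigma \in A by case: (orth_projP A rho).
(* [Q] is the projection onto the kernel of [sigma]. *)
pose Q : 'M[C]_n := 1%:M - hinv sigma *m sigma.
have sQ : sigma *m Q = 0 by rewrite mulmxBr mulmx1 mulmxA mulmx_hinvK // subrr.
have QA : Q \in A by apply: memvB => //; apply: AM => //; exact: hcalc_mem.
suff /eqP : rho *m Q = 0.
  by rewrite mulmxBr mulmx1 mulmxA subr_eq0 eq_sym => /eqP.
apply: psd_kernel => //.
have := frob_orth_proj rho (AM _ _ QA (Astar _ QA)).
rewrite /frob -/sigma sigmah mulmxA sQ mul0mx mxtrace0 => /esym.
by have [-> _] := rho_psd; rewrite mulmxA mxtrace_mulC mulmxA.
Qed.

(** The difference of [tau] and [sigma] in units of [sigma], on the support of
   [sigma]. *)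
Definition deviation sigma tau : 'M[C]_n :=
  hinv_sqrt sigma *m (tau - sigma) *m hinv_sqrt sigma.

(** The scalar [t] of the lift: any nonnegative continuous function of [tau]
   would do that takes the value 1 at [sigma] and keeps [t (G tau G)] below the
   identity, with [G] the square root of the pseudo-inverse of [sigma]. *)
Definition damping sigma tau : C := (1 + entry_sum (deviation sigma tau))^-1.

(** The first summand carries [rho] along with [tau]; the second one corrects its
   projection to [tau] and vanishes at [tau = sigma]. *)
Definition lift_state rho sigma tau : 'M[C]_n :=
  damping sigma tau *: (tau *m hinv sigma *m rho *m (hinv sigma *m tau))
  + (tau - damping sigma tau *: (tau *m hinv sigma *m tau)).

Lemma damping_den_gt0 sigma tau : 0 < 1 + entry_sum (deviation sigma tau).
Proof. by rewrite ltr_wpDr ?entry_sum_ge0. Qed.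

Lemma damping_ge0 sigma tau : 0 <= damping sigma tau.
Proof. by rewrite invr_ge0 ltW // damping_den_gt0. Qed.

Lemma damping_id sigma : damping sigma sigma = 1.
Proof.
rewrite /damping /deviation subrr mulmx0 mul0mx.
rewrite (_ : entry_sum 0 = 0) ?addr0 ?invr1 //.
by rewrite /entry_sum big1 // => i _; rewrite big1 // => j _; rewrite mxE normr0.
Qed.

Lemma cvg_damping sigma (F : set_system 'M[C]_n) (FF : Filter F) :
  F --> sigma -> damping sigma tau @[tau --> F] --> damping sigma sigma.
Proof.
move=> Fs; apply: cvgV; first by rewrite gt_eqF // damping_den_gt0.
apply: cvgD; first exact: cvg_cst.
apply: cvg_entry_sum; apply: cvg_mulmx; last exact: cvg_cst.
apply: cvg_mulmx; first exact: cvg_cst.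
by apply: cvg_mxB => //; exact: cvg_cst.
Qed.

(** With [t = 1 / (1 + c)], the matrix is [t] times the sum of
   [1 - G sigma G] and [c - G (tau - sigma) G], which are both positive
   semidefinite. *)
Lemma psd_1B_damping sigma tau : psd sigma -> psd tau ->
  psd (1%:M - damping sigma tau *: (hinv_sqrt sigma *m tau *m hinv_sqrt sigma)).
Proof.
move=> sigma_psd [tauh _]; have [sigmah _] := sigma_psd.
set G := hinv_sqrt sigma; set t := damping _ _; set e := entry_sum (deviation sigma tau).
have t1 : t * (1 + e) = 1 by rewrite mulVf // gt_eqF // damping_den_gt0.
have -> : 1%:M - t *: (G *m tau *m G) =
    t *: ((1%:M - G *m sigma *m G) + (e%:M - deviation sigma tau)).
  rewrite -{1}t1 -scale_scalar_mx -scalerBr; congr (_ *: _).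
  rewrite /deviation -/G mulmxBr mulmxBl raddfD /= addrACA -opprD.
  by rewrite [_ + (_ - _)]addrC subrK.
apply: psdZ; first exact: damping_ge0.
apply: psdD; first exact: psd_1B_hinv_sqrt_congr.
apply: psd_entry_sum; have [Gh _] := psd_hinv_sqrt sigma_psd.
by rewrite /deviation adjM Gh adjM Gh adjB tauh sigmah mulmxA.
Qed.

Lemma psd_remainder sigma tau : psd sigma -> psd tau ->
  psd (tau - damping sigma tau *: (tau *m hinv sigma *m tau)).
Proof.
move=> sigma_psd tau_psd; have [tauh _] := tau_psd.
have [Gh _] := psd_hinv_sqrt sigma_psd; have [Wh _] := psd_hinv sigma_psd.
have tauGp := psd_1B_damping sigma_psd tau_psd.
set t := damping _ _ in tauGp *; have t0 : 0 <= t by exact: damping_ge0.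
set G := hinv_sqrt sigma in tauGp Gh.
pose Y : 'M[C]_n := 1%:M - t *: (tau *m hinv sigma).
have Yh : Y ^t* = 1%:M - t *: (hinv sigma *m tau).
  by rewrite adjB adj_scalar conjC1 adjZ (geC0_conj t0) adjM Wh tauh.
have -> : tau - t *: (tau *m hinv sigma *m tau) = Y *m tau *m Y ^t* +
    t *: (tau *m G *m (1%:M - t *: (G *m tau *m G)) *m (tau *m G) ^t*).
  by rewrite Yh adjM Gh tauh /Y -hinv_sqrt_sq; exact: damped_square_identity.
exact: (psdD (psd_congr Y tau_psd) (psdZ t0 (psd_congr (tau *m G) tauGp))).
Qed.

Lemma psd_lift_state rho sigma tau : psd rho -> psd sigma -> psd tau ->
  psd (lift_state rho sigma tau).
Proof.
move=> rho_psd sigma_psd tau_psd; apply: psdD; last exact: psd_remainder.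
apply: psdZ; first exact: damping_ge0.
have [tauh _] := tau_psd; have [Wh _] := psd_hinv sigma_psd.
by have := psd_congr (tau *m hinv sigma) rho_psd; rewrite adjM Wh tauh.
Qed.

Lemma lift_state_id rho : psd rho -> psd (orth_proj A rho) ->
  lift_state rho (orth_proj A rho) (orth_proj A rho) = rho.
Proof.
move=> rho_psd sigma_psd; have supp := orth_proj_support rho_psd sigma_psd.
have [rhoh _] := rho_psd; have [sigmah _] := sigma_psd.
have [Wh _] := psd_hinv sigma_psd.
have supp' : orth_proj A rho *m hinv (orth_proj A rho) *m rho = rho.
  have := congr1 (fun X : 'M[C]_n => X ^t*) supp.
  by rewrite adjM adjM rhoh Wh sigmah mulmxA.
by rewrite /lift_state damping_id !scale1r mulmx_hinvK // subrr addr0 supp' mulmxA.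
Qed.

Lemma cvg_lift_state rho (F : set_system 'M[C]_n) (FF : Filter F) :
  psd rho -> psd (orth_proj A rho) -> F --> orth_proj A rho ->
  lift_state rho (orth_proj A rho) tau @[tau --> F] --> rho.
Proof.
move=> rho_psd sigma_psd; have := lift_state_id rho_psd sigma_psd.
set sigma := orth_proj A rho => liftE Fs.
suff lim : lift_state rho sigma tau @[tau --> F] --> lift_state rho sigma sigma.
  by rewrite liftE in lim.
have cvgW : hinv sigma @[_ --> F] --> hinv sigma by exact: cvg_cst.
have cvgr : rho @[_ --> F] --> rho by exact: cvg_cst.
have cvgt : damping sigma tau @[tau --> F] --> damping sigma sigma.
  exact: cvg_damping.
have tauW : tau *m hinv sigma @[tau --> F] --> sigma *m hinv sigma.
  exact: cvg_mulmx Fs cvgW.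
have Wtau : hinv sigma *m tau @[tau --> F] --> hinv sigma *m sigma.
  exact: cvg_mulmx cvgW Fs.
have lin := cvg_mxZ FF cvgt (cvg_mulmx FF (cvg_mulmx FF tauW cvgr) Wtau).
have quad := cvg_mxZ FF cvgt (cvg_mulmx FF tauW Fs).
exact: (cvg_mxD FF lin (cvg_mxB FF Fs quad)).
Qed.

Lemma orth_proj_lift_state rho tau : psd (orth_proj A rho) -> tau \in A ->
  orth_proj A (lift_state rho (orth_proj A rho) tau) = tau.
Proof.
set sigma := orth_proj A rho => -[sigmah _] tauA.
have [_ AM] := A_alg; have [sigmaA _] := orth_projP A rho.
have WA : hinv sigma \in A by exact: hcalc_mem.
have tauWA := AM _ _ tauA WA; have WtauA := AM _ _ WA tauA.
rewrite /lift_state linearD linearB !linearZ /= orth_proj_bimodule // -/sigma.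
rewrite !orth_proj_id //; last exact: AM tauWA tauA.
have -> : tau *m hinv sigma *m sigma *m (hinv sigma *m tau) =
    tau *m (hinv sigma *m sigma *m hinv sigma) *m tau by rewrite !mulmxA.
by rewrite hinv_mulmxK // addrCA scalerN subrr addr0.
Qed.

Lemma lift_state_density rho tau : density {: 'M[C]_n} rho -> density A tau ->
  density {: 'M[C]_n} (lift_state rho (orth_proj A rho) tau).
Proof.
move=> rho_st tau_st.
have sigma_st : density A (orth_proj A rho).
  by apply: orth_proj_density => //; case: A_alg.
have [_ sigma_psd _] := (densityP _ A_alg).1 sigma_st.
have [_ rho_psd _] := (densityP rho (@star_subalgebra_full n)).1 rho_st.
have [tauA tau_psd tau_tr] := (densityP _ A_alg).1 tau_st.
apply/(densityP _ (@star_subalgebra_full n)); split; first exact: memvf.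
  exact: psd_lift_state.
by rewrite -tr_orth_proj orth_proj_lift_state.
Qed.

End Lift.

End StarSubalgebras.

Theorem theorem1p2 (R : realType) (n : nat) (n_ge1 : (1 <= n)%N)
    (A : {vspace 'M[Cplx R]_n}) (A_alg : is_star_subalgebra A) :
  open_map_on (density {:'M[Cplx R]_n}) (density A) (orth_proj A).
Proof.
move=> rho rho_st N NK rhoN.
have [_ rho_psd _] := (densityP rho (@star_subalgebra_full R n)).1 rho_st.
have sigma_st : density A (orth_proj A rho).
  by apply: orth_proj_density => //; case: A_alg.
have [_ sigma_psd _] := (densityP _ A_alg).1 sigma_st.
have lim : (lift_state rho (orth_proj A rho) tau @[tau --> orth_proj A rho] --> rho)%classic.
  exact: (cvg_lift_state A_alg (nbhs_filter _) rho_psd sigma_psd).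
refine (@filterS _ (nbhs (orth_proj A rho)) _ _ _ _ (lim _ rhoN)) => tau liftN tau_st.
have [tauA tau_psd _] := (densityP _ A_alg).1 tau_st.
exists (lift_state rho (orth_proj A rho) tau); last exact: (orth_proj_lift_state A_alg).
by apply: liftN; exact: (lift_state_density A_alg).
Qed.
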